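(* Let $A$ and $B$ be unital semisimple (complex) Banach algebras with essential socle, and let $\Phi:A\to B$ be a bijective linear map. The following conditions are equivalent: (1) $\Phi(A^\wedge)=B^\wedge$, and for all $a,b\in A^\wedge$: $a\leq^- b$ if and only if $\Phi(a)\leq^-\Phi(b)$. (2) $\Phi$ is a Jordan isomorphism multiplied by an invertible element, i.e. there exist an invertible $c\in B$ and a Jordan isomorphism $\Psi:A\to B$ such that $\Phi(x)=c\,\Psi(x)$ for all $x\in A$.
   Context: For a unital ring $R$, an element $a\in R$ is regular if there is $x\in R$ with $axa=a$; $R^\wedge$ is the set of regular elements and $R^\bullet$ the set of idempotents. Write $\mathrm{ann}_l(a)=\{x\in R: xa=0\}$ and $\mathrm{ann}_r(a)=\{x\in R: ax=0\}$. For $a,b\in R$, $a\leq^- b$ means that there exist $p,q\in R^\bullet$ with $\mathrm{ann}_l(a)=\mathrm{ann}_l(p)$, $\mathrm{ann}_r(a)=\mathrm{ann}_r(q)$, $pa=pb$ and $aq=bq$. The socle $\mathrm{Soc}(A)$ of a semisimple Banach algebra $A$ is the sum of all minimal left ideals of $A$ (equivalently of all minimal right ideals), and is $\{0\}$ if there are none. A non-zero ideal $I$ is essential if it has non-zero intersection with every non-zero ideal of $A$; for semisimple $A$ this is equivalent to: $aI=0$ with $a\in A$ implies $a=0$. A linear map $\Psi:A\to B$ is a Jordan homomorphism if $\Psi(a^2)=\Psi(a)^2$ for all $a\in A$; a Jordan isomorphism is a bijective Jordan homomorphism. *)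

(* Defs.v *)
From HB Require Import structures.
From mathcomp Require Import all_boot all_order all_algebra.
From mathcomp Require Import complex.
From mathcomp Require Import boolp classical_sets functions reals topology.
From mathcomp Require Import normedtype.

Set Implicit Arguments.
Unset Strict Implicit.
Unset Printing Implicit Defensive.

Import Order.TTheory GRing.Theory Num.Theory.
Import numFieldNormedType.Exports.

Local Open Scope classical_set_scope.
Local Open Scope ring_scope.

(* A unital Banach algebra over [K] is a Banach space with a unital associative
   bilinear product for which the norm is submultiplicative.  No common
   extension of [normedModType] and [algType] can be declared as a structure on
   top of the existing hierarchy ([numDomainType] already extends both normed
   Z-modules and rings), hence a record; its carrier is then equipped with both
   library structures.  The norm of the unit is not required to be [1], and the
   zero algebra (which has no essential socle) is excluded. *)
Record banachAlgType (K : numFieldType) := BanachAlg {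
  banach_space : completeNormedModType K;
  banach_one : banach_space;
  banach_mul : banach_space -> banach_space -> banach_space;
  banach_mulA : associative banach_mul;
  banach_mul1x : left_id banach_one banach_mul;
  banach_mulx1 : right_id banach_one banach_mul;
  banach_mulDl : left_distributive banach_mul +%R;
  banach_mulDr : right_distributive banach_mul +%R;
  banach_scaleAl : forall (k : K) x y,
    k *: banach_mul x y = banach_mul (k *: x) y;
  banach_scaleAr : forall (k : K) x y,
    k *: banach_mul x y = banach_mul x (k *: y);
  banach_one_neq0 : banach_one != 0;
  banach_normM_le : forall x y, `|banach_mul x y| <= `|x| * `|y|
}.

Definition banach_sort (K : numFieldType) (A : banachAlgType K) : Type :=
  banach_space A.

Coercion banach_sort : banachAlgType >-> Sortclass.

Section BanachAlgebraStructures.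
Variables (K : numFieldType) (A : banachAlgType K).

HB.instance Definition _ :=
  CompleteNormedModule.copy (banach_sort A) (banach_space A).

HB.instance Definition _ := GRing.Zmodule_isNzRing.Build (banach_sort A)
  (@banach_mulA K A) (@banach_mul1x K A) (@banach_mulx1 K A)
  (@banach_mulDl K A) (@banach_mulDr K A) (@banach_one_neq0 K A).

HB.instance Definition _ :=
  GRing.Lmodule_isLalgebra.Build K (banach_sort A) (@banach_scaleAl K A).

HB.instance Definition _ :=
  GRing.Lalgebra_isAlgebra.Build K (banach_sort A) (@banach_scaleAr K A).

Lemma normM_le (x y : A) : `|x * y| <= `|x| * `|y|.
Proof. exact: banach_normM_le. Qed.

End BanachAlgebraStructures.

Section RingNotions.
Variable A : nzRingType.
Implicit Types (a b p q : A) (I J L : set A).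

Definition invertible a : Prop := exists b, a * b = 1 /\ b * a = 1.

Definition regular_elts : set A := [set a | exists x, a * x * a = a].

Definition idempotents : set A := [set p | p * p = p].

Definition ann_l a : set A := [set x | x * a = 0].

Definition ann_r a : set A := [set x | a * x = 0].

Definition minus_le a b : Prop :=
  exists p q, [/\ idempotents p, idempotents q,
                  ann_l a = ann_l p, ann_r a = ann_r q
                & p * a = p * b /\ a * q = b * q].

(* Closure under negation, and under scalars when [A] is an algebra, follows
   from absorption because [A] is unital. *)
Definition left_ideal I : Prop :=
  [/\ I 0, (forall x y, I x -> I y -> I (x + y))
         & (forall a x, I x -> I (a * x))].

Definition ideal I : Prop :=
  left_ideal I /\ (forall x a, I x -> I (x * a)).

Definition maximal_left_ideal L : Prop :=
  [/\ left_ideal L, L <> setT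
    & forall J, left_ideal J -> L `<=` J -> J = L \/ J = setT].

Definition minimal_left_ideal L : Prop :=
  [/\ left_ideal L, L <> [set 0]
    & forall J, left_ideal J -> J `<=` L -> J = [set 0] \/ J = L].

Definition jacobson_radical : set A :=
  \bigcap_(L in maximal_left_ideal) L.

Definition semisimple : Prop := jacobson_radical = [set 0].

(* The empty list contributes [0], so the socle is [set 0] when there is no
   minimal left ideal. *)
Definition socle : set A :=
  [set x | exists2 s : seq A,
     (forall y, y \in s -> exists2 L, minimal_left_ideal L & L y)
     & x = \sum_(y <- s) y].

Definition essential_ideal I : Prop :=
  [/\ ideal I, I <> [set 0]
    & forall J, ideal J -> J <> [set 0] -> I `&` J <> [set 0]].

End RingNotions.

Section JordanMaps.
Variables (K : nzRingType) (A B : algType K).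

Definition jordan_homomorphism (f : {linear A -> B}) : Prop :=
  forall a, f (a ^+ 2) = f a ^+ 2.

Definition jordan_isomorphism (f : {linear A -> B}) : Prop :=
  jordan_homomorphism f /\ bijective f.

End JordanMaps.

(* Main.v *)
(* In a semiprime ring, [a <= b] holds for regular [a], [b]
   iff every inner inverse of [b] is an inner inverse of [a]; Jordan isomorphisms
   preserve the products [a x a], hence the order.

   Conversely, the minimal nonzero regular elements are the rank-one elements
   ([a A a = C a], by the Gelfand-Mazur theorem), so [Phi] preserves them.  Each
   rank-one element is a scalar multiple of a minimal idempotent or a difference
   of two; as [a e <= a] for [a] invertible and [e] idempotent, an inner inverse
   of [Phi a] acts as an inverse on all rank-one elements, so [Phi] preserves
   invertibility and [Psi = (Phi 1)^-1 Phi] maps the minimal idempotents onto the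
   minimal idempotents.  For a minimal idempotent [e], write [e y e = tau_e(y) e].
   Since [a - m e] is invertible iff [m tau_e(a^-1) <> 1], one gets
   [tau_e(a^-1) = tau_(Psi e)((Psi a)^-1)].  Taking [a = 1 - t x] and expanding to
   order two in [t] shows that [Psi e] annihilates [(Psi x)^2 - Psi (x^2)] from
   both sides at once; essentiality of the socle then forces this to vanish. *)
Require Import Defs.
From HB Require Import structures.
From mathcomp Require Import all_boot all_order all_algebra.
From mathcomp Require Import complex ring lra.
From mathcomp Require Import boolp classical_sets functions reals topology.
From mathcomp Require Import normedtype derive.

Set Implicit Arguments.
Unset Strict Implicit.
Unset Printing Implicit Defensive.

Import Order.TTheory GRing.Theory Num.Theory.
Import numFieldNormedType.Exports.
Import Normc.

Local Open Scope classical_set_scope.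
Local Open Scope ring_scope.

(** * The minus order through inner inverses in semiprime rings *)

Definition semiprime (A : nzRingType) : Prop :=
  forall a : A, (forall x, a * x * a = 0) -> a = 0.

Section InnerInverses.
Variable A : nzRingType.
Implicit Types a b c x y : A.

(** Since [1 - p] annihilates [p], it annihilates [a], so [p * a = a]; likewise [a * q = a]. Hence
    [a = p * b = b * q], and [b * x * b = b] can be multiplied by [p] or [q]. *)
Lemma minus_le_inner a b x : minus_le a b -> b * x * b = b ->
  [/\ a * x * a = a, a * x * b = a & b * x * a = a].
Proof.
case=> p [q [pp qq lap raq [pab aqb]]] bxb.
have pa : p * a = a.
  apply/esym/subr0_eq; rewrite -[X in X - _]mul1r -mulrBl.
  have : ann_l p (1 - p) by rewrite /ann_l /= mulrBl mul1r pp subrr.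
  by rewrite -lap.
have aq : a * q = a.
  apply/esym/subr0_eq; rewrite -[X in X - _]mulr1 -mulrBr.
  have : ann_r q (1 - q) by rewrite /ann_r /= mulrBr mulr1 qq subrr.
  by rewrite -raq.
have axb : a * x * b = a by rewrite -pa pab -!mulrA (mulrA b) bxb.
have bxa : b * x * a = a by rewrite -aq aqb mulrA bxb.
by split=> //; rewrite -{2}aq aqb mulrA axb aq.
Qed.

Lemma inner_minus_le a b x :
  a * x * a = a -> a * x * b = a -> b * x * a = a -> minus_le a b.
Proof.
move=> axa axb bxa; exists (a * x), (x * a); split.
- by rewrite /idempotents /= mulrA axa.
- by rewrite /idempotents /= mulrA -(mulrA x) -(mulrA x) axa.
- rewrite /ann_l /ann_r; apply/seteqP; split=> y /= ya; first by rewrite mulrA ya mul0r.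
  by rewrite -axa mulrA ya mul0r.
- rewrite /ann_l /ann_r; apply/seteqP; split=> y /= ya; first by rewrite -mulrA ya mulr0.
  by rewrite -axa -(mulrA a) -(mulrA a) ya mulr0.
- by split; rewrite ?axa ?axb // !mulrA axa bxa.
Qed.

(* If [x] is an inner inverse of [b], so is [x + y] whenever [b * y * b = 0], for
   instance for [y] in [(1 - x * b) A] or in [A (1 - b * x)]. *)
Lemma minus_le_innerP a b : semiprime A -> regular_elts b ->
  minus_le a b <-> (forall x, b * x * b = b -> a * x * a = a).
Proof.
move=> spA [x bxb]; split=> [ab y byb|ab]; first by case: (minus_le_inner ab byb).
have axa := ab _ bxb.
have key y : b * y * b = 0 -> a * y * a = 0.
  move=> byb; apply/(addrI (a * x * a)); rewrite -mulrDl -mulrDr addr0 axa ab //.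
  by rewrite mulrDr mulrDl byb addr0.
have axb : a * (1 - x * b) = 0.
  apply: spA => y.
  have -> : a * (1 - x * b) * y * (a * (1 - x * b)) =
    a * ((1 - x * b) * y) * a * (1 - x * b) by rewrite !mulrA.
  by rewrite key ?mul0r // !mulrA mulrBr mulr1 mulrA bxb subrr !mul0r.
have bxa : (1 - b * x) * a = 0.
  apply: spA => y.
  have -> : (1 - b * x) * a * y * ((1 - b * x) * a) =
    (1 - b * x) * (a * (y * (1 - b * x)) * a) by rewrite !mulrA.
  by rewrite key ?mulr0 // -!mulrA mulrBl mul1r mulrA bxb subrr !mulr0.
apply: (inner_minus_le axa).
  by apply/esym/subr0_eq; rewrite -[RHS]axb mulrBr mulr1 mulrA.
by apply/esym/subr0_eq; rewrite -[RHS]bxa mulrBl mul1r.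
Qed.

Lemma invertible_regular a : invertible a -> regular_elts a.
Proof. by case=> b [ab _]; exists b; rewrite ab mul1r. Qed.

Lemma minus_le_mull c a b : invertible c -> regular_elts b ->
  minus_le a b -> minus_le (c * a) (c * b).
Proof.
move=> [d [cd dc]] [x bxb] /minus_le_inner/(_ bxb) [axa axb bxa].
by apply: (@inner_minus_le _ _ (x * d));
  rewrite -!mulrA (mulrA d) dc mul1r !mulrA -?(mulrA c)
  ?axa ?axb ?bxa.
Qed.

Lemma minus_le_pmull c a b : invertible c -> regular_elts b ->
  minus_le (c * a) (c * b) <-> minus_le a b.
Proof.
move=> cc rb; split=> [|/minus_le_mull]; last exact.
case: (cc) => d [cd dc] /(@minus_le_mull d); rewrite !mulrA dc !mul1r; apply.
  by exists c.
by case: rb => x bxb; exists (x * d);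
  rewrite -!mulrA (mulrA d) dc mul1r !mulrA -(mulrA c) -(mulrA c) bxb.
Qed.

Lemma regular_mull c a : invertible c ->
  regular_elts (c * a) <-> regular_elts a.
Proof.
move=> [d [cd dc]]; split=> [[x ex]|[x ex]].
  by exists (x * c); move/(congr1 ( *%R d)): ex; rewrite !mulrA dc !mul1r.
by exists (x * d); rewrite -!mulrA (mulrA d) dc mul1r !mulrA -(mulrA c) -(mulrA c) ex.
Qed.

End InnerInverses.

(** * Rank-one elements and minimal idempotents *)

Section RankOne.
Variables (K : fieldType) (A : algType K).
Implicit Types (a b d e f g x y : A) (k : K).

Definition rank_one a : Prop := a <> 0 /\ forall x, exists k, a * x * a = k *: a.

(** The corner at [e] is required to consist of scalars, not merely to be a division ring; over
    complex Banach algebras [gelfand_mazur] closes the gap. *)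
Definition minimal_idempotent e : Prop := e * e = e /\ rank_one e.

(** The purely algebraic form in which essentiality of the socle is used. *)
Definition faithful_socle : Prop :=
  forall d, (forall e, minimal_idempotent e -> d * e = 0) -> d = 0.

Lemma rank_one_mull y a : rank_one a -> y * a <> 0 -> rank_one (y * a).
Proof.
move=> [a0 ka] ya; split=> // x; have [k e] := ka (x * y).
by exists k; rewrite scalerAr -e !mulrA.
Qed.

Lemma rank_one_mulr y a : rank_one a -> a * y <> 0 -> rank_one (a * y).
Proof.
move=> [a0 ka] ya; split=> // x; have [k e] := ka (y * x).
by exists k; rewrite scalerAl -e !mulrA.
Qed.

Lemma rank_one_scale k a : k != 0 -> rank_one a -> rank_one (k *: a).
Proof.
move=> k0 [a0 ka]; split=> [/eqP|x].
  by rewrite scaler_eq0 (negPf k0) /= => /eqP.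
have [l e] := ka x; exists (k * l).
by rewrite -scalerAl -scalerAl -scalerAr e !scalerA mulrAC.
Qed.

Hypothesis spA : semiprime A.

Lemma rank_one_regular a : rank_one a -> regular_elts a.
Proof.
move=> [a0 ka]; apply: contrapT => nreg; apply: a0; apply: spA => x.
have [k e] := ka x; rewrite e; case: (eqVneq k 0) => [->|k0].
  by rewrite scale0r.
case: nreg; exists (k^-1 *: x).
by rewrite -scalerAr -scalerAl e scalerA mulVf // scale1r.
Qed.

(** An inner inverse [x] of [a] gives [b = a * (x * b * x) * a], a multiple [k *: a]; then
    [b * x * b = b] leaves only [k = 0] or [b = a]. *)
Lemma minus_le_rank_one a b : rank_one a -> regular_elts b -> minus_le b a ->
  b = 0 \/ b = a.
Proof.
move=> ra rb ba; have [x axa] := rank_one_regular ra.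
have [bxb bxa axb] := minus_le_inner ba axa.
have [k kE] := ra.2 (x * b * x).
have bE : b = k *: a by rewrite -kE -{1}bxa -{1}axb !mulrA.
have [k0|k1] := eqVneq k 0; first by left; rewrite bE k0 scale0r.
right; apply: (scalerI k1).
by rewrite -bE -{1}bxa scalerAr -bE bxb.
Qed.

Lemma minimal_idempotent_mulr a : rank_one a ->
  exists2 y, a * y * a = a & minimal_idempotent (a * y).
Proof.
move=> ra; have [y aya] := rank_one_regular ra; exists y => //.
split; first by rewrite mulrA aya.
by apply: rank_one_mulr => // ay0; case: ra => + _; apply; rewrite -aya ay0 mul0r.
Qed.

(** Write [g * g = k *: g]. If [k] is nonzero, rescaling [g] gives an idempotent. If [k = 0] and
    [g * y * g = g], then both [g * y] and [g * y + g] are idempotent. *)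
Lemma rank_one_decomp g : rank_one g ->
  (exists k e, minimal_idempotent e /\ g = k *: e) \/
  (exists e f, [/\ minimal_idempotent e, minimal_idempotent f & g = e - f]).
Proof.
move=> rg; have [k] := rg.2 1; rewrite mulr1 => gg.
have [k0|k0] := eqVneq k 0; last first.
  left; exists k, (k^-1 *: g); rewrite scalerA mulfV // scale1r; split=> //.
  split; last by apply: rank_one_scale; rewrite ?invr_eq0.
  by rewrite -scalerAl -scalerAr gg !scalerA mulfVK ?mulVf ?mul1r.
right; have [y gyg [ee re]] := minimal_idempotent_mulr rg.
have gg0 : g * g = 0 by rewrite gg k0 scale0r.
exists (g * y + g), (g * y); split=> //; last by rewrite addrAC subrr add0r.
split; last first.
  rewrite -{2}[g]mulr1 -mulrDr; apply: rank_one_mulr => // h.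
  apply: re.1; move/(congr1 ( *%R^~ (g * y))): h.
  by rewrite mul0r mulrDr mulr1 mulrDl ee mulrA gg0 mul0r addr0.
by rewrite mulrDl !mulrDr ee gyg mulrA gg0 mul0r !addr0.
Qed.

Hypothesis fsA : faithful_socle.

Lemma rank_one_annr d : (forall f, rank_one f -> d * f = 0) -> d = 0.
Proof. by move=> df; apply: fsA => e [_ /df]. Qed.

Lemma rank_one_annl d : (forall f, rank_one f -> f * d = 0) -> d = 0.
Proof.
move=> fd; apply: fsA => e [_ re]; apply: spA => y.
have -> : d * e * y * (d * e) = d * (e * y * d) * e by rewrite !mulrA.
case: (pselect (e * y = 0)) => [->|ey]; first by rewrite mul0r mulr0 mul0r.
by rewrite fd ?mulr0 ?mul0r //; apply: rank_one_mulr.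
Qed.

(** Perturbing [e] to the minimal idempotent [e + n], with [n = e * y * (1 - e)] of square zero,
    turns the hypothesis into [e * y * d * e = 0] for every [y]; semiprimeness then gives
    [d * e = 0]. *)
Lemma minimal_idempotent_sandwich d :
  (forall e, minimal_idempotent e -> e * d * e = 0) -> d = 0.
Proof.
move=> ede; apply: fsA => e me; apply: spA => y; have [ee re] := me.
set n := e * y * (1 - e).
have ne : n * e = 0 by rewrite /n -mulrA mulrBl mul1r ee subrr mulr0.
have en : e * n = n by rewrite /n !mulrA ee.
have nn : n * n = 0 by rewrite -{2}en mulrA ne mul0r.
have : minimal_idempotent (e + n).
  split; first by rewrite mulrDl !mulrDr ee ne nn en !addr0.
  have E : e + n = e * (1 + y * (1 - e)) by rewrite mulrDr mulr1 mulrA.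
  rewrite E; apply: rank_one_mulr => //; rewrite -E => h; apply: re.1.
  by rewrite -[LHS]addr0 -ne -{1}ee -mulrDl h mul0r.
move/ede/(congr1 ( *%R^~ e)); rewrite mul0r -mulrA [X in _ * X]mulrDl ne ee addr0.
rewrite !mulrDl ede // add0r /n mulrBr mulr1 !mulrBl.
rewrite -[e * y * e * d * e]mulrA -[e * y * e * (d * e)]mulrA (mulrA e d) ede //.
rewrite mulr0 subr0 => eyde.
have -> : d * e * y * (d * e) = d * (e * y * d * e) by rewrite !mulrA.
by rewrite eyde mulr0.
Qed.

Lemma rank_one_below a : regular_elts a -> a <> 0 ->
  exists2 f, rank_one f & minus_le f a.
Proof.
move=> [x axa] a0; apply: contrapT => nex; apply: a0.
suff p0 : a * x = 0 by rewrite -axa p0 mul0r.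
apply: fsA => e [ee re]; apply: contrapT => pe0.
have [p pE] : exists p, p = a * x by exists (a * x).
have pp : p * p = p by rewrite pE mulrA axa.
have pa : p * a = a by rewrite pE.
rewrite -pE in pe0.
have rpe := rank_one_mull re pe0.
have [z pez] := rank_one_regular rpe.
(* This is an idempotent of the corner at [p = a * x], of rank one because of the factor [p * e];
   since [p * a = a], the element [f * a] lies below [a]. *)
have [f fE] : exists f, f = p * e * z * p by exists (p * e * z * p).
have ff : f * f = f.
  have -> : f * f = p * e * z * (p * p * e) * z * p by rewrite fE !mulrA.
  by rewrite pp pez.
have fa0 : f * a <> 0.
  move=> fa; apply: pe0; rewrite -pez.
  have -> : p * e * z * (p * e) = p * e * z * (p * p * e) by rewrite pp.
  have -> : p * e * z * (p * p * e) = f * a * (x * e) by rewrite fE pE !mulrA.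
  by rewrite fa mul0r.
have rf : rank_one (f * a).
  have faE : f * a = p * e * (z * p * a) by rewrite fE !mulrA.
  by rewrite faE; apply: rank_one_mulr; rewrite // -faE.
have pf : p * f = f by rewrite fE !mulrA pp.
apply: nex; exists (f * a) => //; apply: (@inner_minus_le _ _ _ x).
- have -> : f * a * x * (f * a) = f * (p * f) * a by rewrite pE !mulrA.
  by rewrite pf ff.
- have -> : f * a * x * a = f * (p * a) by rewrite pE !mulrA.
  by rewrite pa.
- by rewrite -pE mulrA pf.
Qed.

Lemma rank_oneP a : regular_elts a -> a <> 0 ->
  rank_one a <->
  (forall b, regular_elts b -> minus_le b a -> b = 0 \/ b = a).
Proof.
move=> rega a0; split=> [ra b|h]; first exact: minus_le_rank_one.
have [f rf fa] := rank_one_below rega a0.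
by case: (h f (rank_one_regular rf) fa) => [f0|<-//]; case: rf.
Qed.

End RankOne.

(** * Linear maps preserving the minus order *)

Section LinearMaps.
Variable K : fieldType.
Implicit Types A B : algType K.

Lemma bijective_linear_inverse A B (Phi : {linear A -> B}) : bijective Phi ->
  exists2 Psi : {linear B -> A}, cancel Phi Psi & cancel Psi Phi.
Proof.
case=> g fK gK.
have glin : linear g.
  by move=> k x y; apply: (can_inj fK); rewrite linearP !gK.
pose L := GRing.isLinear.Build K B A *:%R g glin.
by exists (HB.pack g L : {linear B -> A}).
Qed.

Definition preserves_minus A B (Phi : A -> B) : Prop :=
  Phi @` @regular_elts A = @regular_elts B /\
  (forall a b : A, regular_elts a -> regular_elts b ->
     (minus_le a b <-> minus_le (Phi a) (Phi b))).

Lemma preserves_minus_regular A B (Phi : A -> B) (a : A) :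
  injective Phi -> preserves_minus Phi ->
  regular_elts a <-> regular_elts (Phi a).
Proof.
move=> inj [im _]; rewrite -im; split=> [ra|[x rx /inj <-//]].
by exists a.
Qed.

Lemma preserves_minus_inv A B (Phi : A -> B) (Psi : B -> A) :
  cancel Phi Psi -> cancel Psi Phi -> preserves_minus Phi ->
  preserves_minus Psi.
Proof.
move=> fK gK pm; have inj := can_inj fK.
have reg := @preserves_minus_regular _ _ _ _ inj pm.
split=> [|a b ra rb]; last first.
  rewrite (pm.2 (Psi a) (Psi b)) ?gK //; by apply/reg; rewrite gK.
apply/seteqP; split=> [_ [b rb <-]|a ra].
  by apply/reg; rewrite gK.
by exists (Phi a); [apply/reg|rewrite fK].
Qed.

Lemma preserves_minus_rank_one A B (Phi : {linear A -> B}) a :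
  semiprime A -> faithful_socle A -> semiprime B -> faithful_socle B ->
  bijective Phi -> preserves_minus Phi -> rank_one a -> rank_one (Phi a).
Proof.
move=> spA fsA spB fsB bij pm ra.
have inj := bij_inj bij; have [g fK gK] := bij.
have reg := @preserves_minus_regular _ _ _ _ inj pm.
have rega := rank_one_regular spA ra.
have a0 := ra.1.
apply/rank_oneP => //; first exact/reg.
  by move=> h; apply: a0; apply: inj; rewrite h linear0.
move=> b; rewrite -(gK b) -reg => rb /(pm.2 _ _ rb rega) ba.
have [->|->] := minus_le_rank_one spA ra rb ba; last by right.
by left; rewrite linear0.
Qed.

Lemma minimal_idempotent_le A (e a : A) : e * e = e -> invertible a ->
  minus_le (a * e) a.
Proof.
move=> ee inva; rewrite -[X in minus_le _ X]mulr1; apply: minus_le_mull => //.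
  by exists 1; rewrite !mulr1.
by apply: (@inner_minus_le _ _ _ 1); rewrite ?mulr1 ?mul1r.
Qed.

Lemma preserves_minus_invertible A B (Phi : {linear A -> B}) a :
  semiprime A -> faithful_socle A -> semiprime B -> faithful_socle B ->
  bijective Phi -> preserves_minus Phi -> invertible a -> invertible (Phi a).
Proof.
move=> spA fsA spB fsB bij pm inva.
have [Psi fK gK] := bijective_linear_inverse bij.
have inj := bij_inj bij.
have reg := @preserves_minus_regular _ _ _ _ inj pm.
have rega := invertible_regular inva.
have [v ava] := (reg a).1 rega.
have idem e : minimal_idempotent e ->
    Phi a * v * Phi (a * e) = Phi (a * e) /\ Phi (a * e) * v * Phi a = Phi (a * e).
  move=> [ee _].
  have : minus_le (Phi (a * e)) (Phi a).
    apply/pm.2 => //; last exact: minimal_idempotent_le.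
    apply/regular_mull => //; by exists 1; rewrite mulr1.
  by move=> /minus_le_inner/(_ ava) [].
have rk1 h : rank_one h ->
    Phi a * v * Phi (a * h) = Phi (a * h) /\ Phi (a * h) * v * Phi a = Phi (a * h).
  move=> /(rank_one_decomp spA).
  move=> [[k [e [/idem [h1 h2] ->]]]|[e [f [/idem [h1 h2] /idem [h3 h4] ->]]]].
    by rewrite -!scalerAr linearZ /= -scalerAr -!scalerAl h1 h2.
  by rewrite mulrBr linearB /= mulrBr !mulrBl h1 h2 h3 h4.
(* Every rank-one [f] of [B] has the form [Phi (a * h)] with [h = w * Psi f] of rank one, because
   the inverse map preserves rank one too. *)
have rkB f : rank_one f -> Phi a * v * f = f /\ f * v * Phi a = f.
  case: inva => w [aw wa] rf.
  have rPf : rank_one (Psi f).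
    apply: preserves_minus_rank_one => //; first by exists Phi.
    exact: preserves_minus_inv fK gK pm.
  have : rank_one (w * Psi f).
    apply: rank_one_mull => // h; case: rPf => + _; apply.
    by rewrite -[LHS]mul1r -aw -mulrA h mulr0.
  by move/rk1; rewrite mulrA aw mul1r gK.
exists v; split; apply/subr0_eq.
  by apply: (rank_one_annr fsB) => f /rkB [h _]; rewrite mulrBl h mul1r subrr.
by apply: (rank_one_annl spB fsB) => f /rkB [_ h]; rewrite mulrBr mulrA h mulr1 subrr.
Qed.

(** The Sherman-Morrison formula for a rank-one perturbation: if [m * k = 1], the nonzero element
    [w * e] is killed by [a - m *: e]; otherwise the inverse is [w + c *: (w * e * w)] with
    [c = m / (1 - m * k)]. *)
Lemma invertible_sub_minimal_idempotent A (e a w : A) (k m : K) :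
  minimal_idempotent e -> a * w = 1 -> w * a = 1 -> e * w * e = k *: e ->
  invertible (a - m *: e) <-> m * k != 1.
Proof.
move=> [ee [e0 _]] aw wa ewe; split=> [[b [_ bE]]|mk].
  apply/eqP => mk.
  have z : (a - m *: e) * (w * e) = 0.
    by rewrite mulrBl mulrA aw mul1r -scalerAl mulrA ewe scalerA mk scale1r subrr.
  have we0 : w * e = 0 by rewrite -[LHS]mul1r -bE -mulrA z mulr0.
  by apply: e0; rewrite -[LHS]mul1r -aw -mulrA we0 mulr0.
have mk' : 1 - m * k != 0 by rewrite subr_eq0 eq_sym.
set c := m / (1 - m * k).
have cE : c - m - m * c * k = 0.
  by rewrite /c; field.
exists (w + c *: (w * e * w)); split.
  rewrite mulrDr !mulrBl -!scalerAr -!scalerAl !mulrA aw mul1r ewe.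
  rewrite -!scalerAl !scalerA -addrA [X in 1 + X](_ : _ = 0) ?addr0 //.
  rewrite -scaleNr -scalerBl -scalerDl.
  by rewrite [X in X *: _](_ : _ = 0) ?scale0r // -cE; ring.
rewrite mulrDl !mulrBr -!scalerAr -!scalerAl -!mulrA wa mulr1 (mulrA e w e) ewe.
rewrite -!scalerAr !scalerA -addrA [X in 1 + X](_ : _ = 0) ?addr0 //.
rewrite -scaleNr -scalerBl -scalerDl.
by rewrite [X in X *: _](_ : _ = 0) ?scale0r // -cE; ring.
Qed.

(* [a - m *: e] is singular exactly for [m = k^-1], so [k] is determined by the
   invertible elements alone. *)
Lemma compression_inverse A B (Psi : {linear A -> B}) (e a w : A) (W : B) (k l : K) :
  (forall x, invertible x <-> invertible (Psi x)) ->
  minimal_idempotent e -> minimal_idempotent (Psi e) ->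
  a * w = 1 -> w * a = 1 -> Psi a * W = 1 -> W * Psi a = 1 ->
  e * w * e = k *: e -> Psi e * W * Psi e = l *: Psi e -> k = l.
Proof.
move=> inv me mE aw wa aW Wa ke lE.
have kl m : m * k != 1 <-> m * l != 1.
  rewrite -(invertible_sub_minimal_idempotent m me aw wa ke).
  rewrite -(invertible_sub_minimal_idempotent m mE aW Wa lE).
  by rewrite inv linearB linearZ.
have aux (x y : K) : (forall m, m * x != 1 <-> m * y != 1) -> x != 0 -> x = y.
  move=> xy x0; have := xy x^-1; rewrite mulVf // eqxx => -[_ h].
  have /eqP : x^-1 * y == 1 by apply: contraT => /h.
  by move/(congr1 ( *%R x)); rewrite mulVKf // mulr1.
have [k0|/(aux _ _ kl)//] := eqVneq k 0.
have [l0|l0] := eqVneq l 0; first by rewrite k0 l0.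
by apply/esym/aux => // m; rewrite kl.
Qed.

End LinearMaps.

(** * Jordan isomorphisms preserve the minus order *)

Section JordanHomomorphisms.
Variables (K : fieldType) (A B : algType K) (Psi : {linear A -> B}).
Hypothesis two_neq0 : (2 : K) != 0.
Hypothesis jPsi : jordan_homomorphism Psi.

Lemma jordan_mulD a b : Psi (a * b + b * a) = Psi a * Psi b + Psi b * Psi a.
Proof.
have := jPsi (a + b); rewrite linearD !expr2 !mulrDl !mulrDr !linearD /= -!expr2 !jPsi.
by rewrite !addrA => /addIr; rewrite -!addrA => /addrI.
Qed.

(* [2 a b a = a (ab + ba) + (ab + ba) a - (a^2 b + b a^2)] *)
Lemma jordan_triple a b : Psi (a * b * a) = Psi a * Psi b * Psi a.
Proof.
have two (V : algType K) (x y : V) :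
    x * (x * y + y * x) + (x * y + y * x) * x =
    2 *: (x * y * x) + (x ^+ 2 * y + y * x ^+ 2).
  rewrite mulrDl mulrDr !expr2 !mulrA scaler_nat mulr2n.
  by rewrite [X in X + _ = _]addrC addrACA.
apply: (scalerI two_neq0).
have := congr1 Psi (two _ a b).
rewrite !jordan_mulD two linearD linearZ /= jordan_mulD jPsi.
by move/addIr/esym.
Qed.

Lemma jordan_preserves_minus : semiprime A -> semiprime B -> bijective Psi ->
  preserves_minus Psi.
Proof.
move=> spA spB bij; have inj := bij_inj bij; have [g fK gK] := bij.
have eqv a x : a * x * a = a <-> Psi a * Psi x * Psi a = Psi a.
  by rewrite -jordan_triple; split=> [->//|/inj].
have reg a : regular_elts a <-> regular_elts (Psi a).
  split=> [[x /eqv ax]|[y ay]]; first by exists (Psi x).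
  by exists (g y); apply/eqv; rewrite gK.
split=> [|a b ra rb].
  apply/seteqP; split=> [_ [a ra <-]|b rb]; first exact/reg.
  by exists (g b); rewrite ?gK //; apply/reg; rewrite gK.
rewrite !minus_le_innerP //; last exact/reg.
split=> h y; last by move/eqv/h/eqv.
by rewrite -(gK y) => /eqv/h/eqv.
Qed.

End JordanHomomorphisms.

Lemma preserves_minus_mull (K : fieldType) (A B : algType K) (Phi Psi : A -> B)
  (c : B) : invertible c -> (forall x, Phi x = c * Psi x) ->
  preserves_minus Psi -> preserves_minus Phi.
Proof.
move=> invc PhiE [im le]; have rc x := regular_mull x invc.
split=> [|a b ra rb]; last first.
  rewrite !PhiE minus_le_pmull //; first exact: le.
  by rewrite -im; exists b.
apply/seteqP; split=> [_ [a ra <-]|b rb].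
  by rewrite PhiE; apply/rc; rewrite -im; exists a.
have [d [cd dc]] := invc.
have : regular_elts (d * b) by apply/rc; rewrite mulrA cd mul1r.
by rewrite -im => -[a ra aE]; exists a; rewrite // PhiE aE mulrA cd mul1r.
Qed.

(** * A maximum principle in the plane and the mean value identity for resolvents *)

Section MaximumPrinciple.
Variables (R : realType) (f : R * R -> R).
Hypothesis f_ge0 : forall p, 0 <= f p.

Lemma resolvent_bound_continuous :
  (forall p q, `|f p - f q| <= (`|p.1 - q.1| + `|p.2 - q.2|) * (f p * f q)) ->
  continuous f.
Proof.
move=> fB p; apply/cvgrPdist_le => e e0; set F := f p.
have F0 : 0 <= F by exact: f_ge0.
(* The denominator ensures [d * F <= 1 / 4], which yields the a priori bound [f q <= 2 * F], and
   [4 * d * F ^+ 2 <= e], which then closes the estimate. *)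
pose d := Num.min e 1 / (4 * F ^+ 2 + 4 * F + 1).
have D0 : 0 < 4 * F ^+ 2 + 4 * F + 1 by nra.
have m0 : 0 < Num.min e 1 by rewrite lt_min e0 ltr01.
have d0 : 0 < d by rewrite divr_gt0.
have dD : d * (4 * F ^+ 2 + 4 * F + 1) = Num.min e 1 by rewrite /d divfK // gt_eqF.
have m1 : Num.min e 1 <= 1 by rewrite ge_min lexx orbT.
have me : Num.min e 1 <= e by rewrite ge_min lexx.
exists (ball p.1 d, ball p.2 d); first by split; exact: nbhsx_ballx.
move=> q [/= b1 b2].
rewrite /ball /= in b1 b2.
have G0 : 0 <= f q by exact: f_ge0.
have := fB p q; rewrite -/F => h.
have h1 : `|F - f q| <= (2 * d) * (F * f q).
  by apply: (le_trans h); rewrite ler_wpM2r ?mulr_ge0 //; lra.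
have h2 : d * F <= 1 / 4 by nra.
have h3 : f q <= F + `|F - f q|.
  by have := ler_norm (f q - F); rewrite distrC; lra.
have h4 : f q <= 2 * F.
  have : 2 * (d * F) * f q <= f q / 2 by nra.
  nra.
apply: (le_trans h1); apply: le_trans me; rewrite -dD.
have : F * f q <= F * (2 * F) by rewrite ler_wpM2l.
nra.
Qed.

Hypothesis f_cont : continuous f.
(* Subharmonicity up to an error of order [h ^+ 4]. *)
Hypothesis f_mean : forall s t h, 4 * f (s, t) <=
  (f (s + h, t) + f (s, t + h) + f (s - h, t) + f (s, t - h)) *
  (1 + h ^+ 4 * f (s, t) ^+ 4).
Hypothesis f_decay : forall e, 0 < e -> exists2 r, 0 < r &
  forall p, r <= `|p.1| \/ r <= `|p.2| -> f p <= e.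

(* The perturbation [eps * (s^2 + t^2)] dominates the error in the mean value
   inequality, so [f + eps * (s^2 + t^2)] has no local maximum. *)
Lemma subharmonic_decay_eq0 : f (0, 0) = 0.
Proof.
apply/eqP; rewrite eq_le f_ge0 andbT leNgt; apply/negP => f0.
have [r r0 fr] := f_decay (divr_gt0 f0 (ltr0n _ 2)).
(* On the square of half-side [r] the perturbation is at most [f (0, 0) / 4], while [f] is at most
   [f (0, 0) / 2] on its boundary; so the maximum of [g] is interior. *)
pose eps := f (0, 0) / (8 * r ^+ 2).
have r2 : 0 < r ^+ 2 by rewrite exprn_gt0.
have epsE : eps * (8 * r ^+ 2) = f (0, 0) by rewrite /eps divfK // gt_eqF // mulr_gt0.
have eps0 : 0 < eps by rewrite divr_gt0 // mulr_gt0.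
pose g p := f p + eps * (p.1 ^+ 2 + p.2 ^+ 2).
have gc : continuous g.
  move=> p; apply: cvgD; first exact: f_cont.
  apply: cvgM; first exact: cvg_cst.
  by apply: cvgD; rewrite expr2; apply: cvgM; first [exact: cvg_fst|exact: cvg_snd].
pose Q := `[- r, r]%classic `*` `[- r, r]%classic : set (R * R).
have Q0 : Q (0, 0) by rewrite /Q /= !in_itv /= !oppr_le0 ltW.
have cQ : compact Q by apply: compact_setX; exact: segment_compact.
have [|c cQ' gmax] := @compact_EVT_max _ R g Q _ cQ (continuous_subspaceT gc).
  by exists (0, 0).
have {}gmax p : Q p -> g p <= g c by move=> Qp; apply: gmax; rewrite inE.
move: cQ'; rewrite inE; case: c gmax => s t gmax [] /=.
rewrite !in_itv /= => /andP[s1 s2] /andP[t1 t2].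
have g0 := gmax _ Q0; rewrite /g /= in g0.
have bnd : `|s| < r /\ `|t| < r.
  suff nb : ~ (r <= `|s| \/ r <= `|t|).
    by split; rewrite ltNge; apply/negP => h; apply: nb; [left|right].
  move=> /(fr (s, t)) fst.
  have : s ^+ 2 <= r ^+ 2 by nra.
  have : t ^+ 2 <= r ^+ 2 by nra.
  nra.
case: bnd => sr tr.
set F := f (s, t) in g0 *.
have F0 : 0 <= F by exact: f_ge0.
(* The last two bounds keep the four neighbours inside the square. The first two give
   [h ^+ 2 * F ^+ 5 <= h * F ^+ 5 < eps], against the mean value inequality. *)
pose h := Num.min (Num.min 1 (eps / (F ^+ 5 + 1))) (Num.min (r - `|s|) (r - `|t|)).
have F50 : 0 <= F ^+ 5 by rewrite exprn_ge0.
have h0 : 0 < h by rewrite !lt_min ltr01 !subr_gt0 sr tr divr_gt0 //; lra.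
have [[h1 he] [hs ht]] : (h <= 1 /\ h <= eps / (F ^+ 5 + 1)) /\
   (h <= r - `|s| /\ h <= r - `|t|).
  by have := lexx h; rewrite {2}/h !le_min => /andP[/andP[-> ->] /andP[-> ->]].
have {}he : h * (F ^+ 5 + 1) <= eps by rewrite -ler_pdivlMr //; lra.
have [sl su] : - `|s| <= s /\ s <= `|s|.
  by split; [rewrite lerNl -normrN|]; rewrite ler_norm.
have [tl tu] : - `|t| <= t /\ t <= `|t|.
  by split; [rewrite lerNl -normrN|]; rewrite ler_norm.
clearbody eps h.
have q1 : Q (s + h, t) by rewrite /Q /= !in_itv /=; split; apply/andP; split; lra.
have q2 : Q (s, t + h) by rewrite /Q /= !in_itv /=; split; apply/andP; split; lra.
have q3 : Q (s - h, t) by rewrite /Q /= !in_itv /=; split; apply/andP; split; lra.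
have q4 : Q (s, t - h) by rewrite /Q /= !in_itv /=; split; apply/andP; split; lra.
have {q1 q2 q3 q4} [q1 q2 q3 q4] := And4 (gmax _ q1) (gmax _ q2) (gmax _ q3) (gmax _ q4).
rewrite /g /= -/F in q1 q2 q3 q4.
have := f_mean s t h; rewrite -/F.
set T := (X in _ <= X * _) => fm.
have TB : T <= 4 * F - 4 * eps * h ^+ 2 by rewrite /T; lra.
have fm2 : 4 * F <= (4 * F - 4 * eps * h ^+ 2) * (1 + h ^+ 4 * F ^+ 4).
  apply: (le_trans fm); rewrite ler_wpM2r // addr_ge0 // mulr_ge0 // exprn_ge0 //.
  exact: ltW.
have e1 : eps * h ^+ 2 <= h ^+ 4 * F ^+ 5.
  have : 0 <= eps * h ^+ 2 * (h ^+ 4 * F ^+ 4).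
    by rewrite !mulr_ge0 ?exprn_ge0 ?(ltW h0) ?(ltW eps0).
  by lra.
have h20 : 0 < h ^+ 2 by rewrite exprn_gt0.
have e2 : eps <= h ^+ 2 * F ^+ 5.
  by rewrite -(ler_pM2r h20) (le_trans e1) // le_eqVlt; apply/orP; left; apply/eqP; ring.
have : h ^+ 2 * F ^+ 5 <= h * F ^+ 5 by rewrite ler_wpM2r // expr2 ler_piMl // ltW.
lra.
Qed.

End MaximumPrinciple.

(* [y1], ..., [y4] are the values of a resolvent at the vertices of a square
   centred at a point where its value is [X]. *)
Lemma resolvent_mean (K : fieldType) (A : algType K) (X y1 y2 y3 y4 : A) (i z : K) :
  i ^+ 2 = -1 ->
  y1 = X + z *: (X * y1) -> y2 = X + (i * z) *: (X * y2) ->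
  y3 = X + (- z) *: (X * y3) -> y4 = X + (- (i * z)) *: (X * y4) ->
  4 *: X = (y1 + y3 + (y2 + y4)) - z ^+ 4 *: (X ^+ 4 * (y1 + y3 + (y2 + y4))).
Proof.
move=> ii e1 e2 e3 e4.
(* Iterating [y = X + u *: (X * y)] leaves the remainder [u ^+ 4 *: (X ^+ 4 * y)] and a cubic
   polynomial in [u], split here into even and odd parts. Over the four vertices the odd parts
   cancel, and so do the quadratic terms since [i ^+ 2 = -1]. *)
pose ev (u : K) := X + u ^+ 2 *: X ^+ 3.
pose od (u : K) := u *: X ^+ 2 + u ^+ 3 *: X ^+ 4.
have step y u : y = X + u *: (X * y) -> y - u ^+ 4 *: (X ^+ 4 * y) = ev u + od u.
  move=> E.
  have En n : X ^+ n * y = X ^+ n.+1 + u *: (X ^+ n.+1 * y).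
    by rewrite {1}E mulrDr -exprSr -scalerAr mulrA -exprSr.
  apply/eqP; rewrite subr_eq; apply/eqP.
  rewrite {1}E -{2}[X]expr1 (En 1%N) (En 2%N) (En 3%N) /ev /od.
  rewrite !scalerDr !scalerA -!expr2 -!exprSr !addrA; congr (_ + _ + _).
  by rewrite addrAC.
have N4 (u : K) : (- u) ^+ 4 = u ^+ 4 by ring.
have i4 : (i * z) ^+ 4 = z ^+ 4.
  by rewrite exprMn (exprM i 2 2) ii sqrrN expr1n mul1r.
have evN u : ev (- u) = ev u by rewrite /ev sqrrN.
have odN u : od (- u) = - od u.
  by rewrite /od (_ : (- u) ^+ 3 = - u ^+ 3); [rewrite !scaleNr opprD|ring].
have evi : ev (i * z) = X - z ^+ 2 *: X ^+ 3.
  by rewrite /ev exprMn ii mulN1r scaleNr.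
have {}e1 := step _ _ e1; have {}e2 := step _ _ e2.
have {}e3 := step _ _ e3; have {}e4 := step _ _ e4.
rewrite N4 evN odN in e3; rewrite N4 evN odN in e4; rewrite i4 in e2 e4.
have pair (u v : A) : (u + v) + (u - v) = u *+ 2.
  by rewrite addrACA subrr addr0 mulr2n.
pose L (u : A) := u - z ^+ 4 *: (X ^+ 4 * u).
have LD u v : L (u + v) = L u + L v.
  by rewrite /L mulrDr scalerDr opprD addrACA.
rewrite -[RHS]/(L _) !LD /L e1 e2 e3 e4 !pair evi -mulrnDl /ev pair.
by rewrite scaler_nat -mulrnA.
Qed.

(** * Real-valued norms, Neumann series and a Liouville theorem for resolvents *)

Section BanachNorm.
Variables (R : realType) (A : banachAlgType R[i]).
Implicit Types (a b x y : A) (k z : R[i]).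

(* The library norm of [A] takes its values in [R[i]]. *)
Definition rnorm a : R := complex.Re `|a|.

Lemma rnormE a : `|a| = (rnorm a)%:C%C.
Proof. by rewrite /rnorm RRe_real // normr_real. Qed.

Lemma rnorm_ge0 a : 0 <= rnorm a.
Proof. by rewrite -ler0c -rnormE. Qed.

Lemma rnorm_eq0 a : rnorm a = 0 -> a = 0.
Proof. by move=> a0; apply/eqP; rewrite -normr_eq0 rnormE a0. Qed.

Lemma rnorm_gt0 a : a <> 0 -> 0 < rnorm a.
Proof.
by move=> a0; rewrite lt_def rnorm_ge0 andbT; apply/eqP => /rnorm_eq0.
Qed.

Lemma rnormD a b : rnorm (a + b) <= rnorm a + rnorm b.
Proof. by rewrite -lecR rmorphD /= -!rnormE ler_normD. Qed.

Lemma rnormN a : rnorm (- a) = rnorm a.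
Proof. by rewrite /rnorm normrN. Qed.

Lemma rnormM a b : rnorm (a * b) <= rnorm a * rnorm b.
Proof. by rewrite -lecR rmorphM /= -!rnormE normM_le. Qed.

Lemma rnormZ k a : rnorm (k *: a) = normc k * rnorm a.
Proof.
by apply: (@complexI R); rewrite rmorphM /= -!rnormE normrZ.
Qed.

Lemma rnorm_dist a b : `|rnorm a - rnorm b| <= rnorm (a - b).
Proof.
have h1 := rnormD (a - b) b; rewrite subrK in h1.
have h2 := rnormD (b - a) a; rewrite subrK -opprB rnormN in h2.
by rewrite ler_norml; apply/andP; split; lra.
Qed.

Lemma normc_le_abs (s t : R) : normc (s +i* t)%C <= `|s| + `|t|.
Proof.
rewrite /= -(@ler_pXn2r _ 2) ?nnegrE ?sqrtr_ge0 ?addr_ge0 //.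
rewrite sqr_sqrtr ?addr_ge0 ?sqr_ge0 //.
rewrite -(real_normK (num_real s)) -(real_normK (num_real t)).
have := normr_ge0 s; have := normr_ge0 t; nra.
Qed.

Lemma normc_ge_abs (s t : R) : `|s| <= normc (s +i* t)%C /\ `|t| <= normc (s +i* t)%C.
Proof.
by split; rewrite /= -sqrtr_sqr ler_wsqrtr // ?lerDl ?lerDr sqr_ge0.
Qed.

Lemma normc_nat n : normc (n%:R : R[i]) = n%:R.
Proof.
apply: (@complexI R); rewrite rmorph_nat.
transitivity (`|n%:R : R[i]|); first by [].
by rewrite normr_nat.
Qed.

Lemma normc_ge0 z : 0 <= normc z.
Proof. by case: z => s t; exact: sqrtr_ge0. Qed.

Lemma normc_opp z : normc (- z) = normc z.
Proof. exact: (normcN (z : Rcomplex R)). Qed.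

Lemma normc_real4 (h : R) : normc (h%:C%C ^+ 4) = h ^+ 4.
Proof.
rewrite -rmorphXn /= expr0n addr0 sqrtr_sqr ger0_norm //.
by rewrite (exprM h 2 2) sqr_ge0.
Qed.

Lemma exp_half_small (C e : R) : 0 <= C -> 0 < e -> exists n, (2^-1) ^+ n * C < e.
Proof.
move=> C0 e0; exists (Num.bound (C / e)).
have := archi_boundP (divr_ge0 C0 (ltW e0)); set n := Num.bound _ => Cn.
have : C < n%:R * e by rewrite -ltr_pdivrMr.
have : (n%:R : R) <= 2 ^+ n by rewrite -natrX ler_nat ltnW // ltn_expl.
move=> n2 Cne; rewrite exprVn mulrC ltr_pdivrMr ?exprn_gt0 // mulrC.
by apply: (lt_le_trans Cne); rewrite ler_wpM2r // ltW.
Qed.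

(** The partial sums of the geometric series are Cauchy because [s (n + m) - s n = y ^+ n * s m].
    The bound carries [rnorm 1], as the unit need not have norm one. *)
Lemma neumann_inverse y : rnorm y <= 2^-1 ->
  exists w, [/\ (1 - y) * w = 1, w * (1 - y) = 1 & rnorm w <= 2 * rnorm 1].
Proof.
move=> y2; pose s n := \sum_(i < n) y ^+ i.
have sS n : s n.+1 = 1 + y * s n.
  rewrite /s big_ord_recl expr0; congr (_ + _).
  by rewrite mulr_sumr; apply: eq_bigr => i _; rewrite -exprS.
have sSr n : s n.+1 = 1 + s n * y.
  rewrite /s big_ord_recl expr0; congr (_ + _).
  by rewrite mulr_suml; apply: eq_bigr => i _; rewrite -exprSr.
have sl n : (1 - y) * s n = 1 - y ^+ n.
  elim: n => [|n ih]; first by rewrite /s big_ord0 mulr0 expr0 subrr.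
  by rewrite sSr mulrDr mulr1 mulrA ih exprSr mulrBl mul1r addrA subrK.
have sr n : s n * (1 - y) = 1 - y ^+ n.
  have cs : y * s n = s n * y by apply/(addrI 1); rewrite -sS -sSr.
  by rewrite -sl mulrBr mulrBl mul1r mulr1 cs.
have sb n : rnorm (s n) <= 2 * rnorm 1.
  elim: n => [|n ih]; first by rewrite /s big_ord0 /rnorm normr0 /= mulr_ge0 // rnorm_ge0.
  rewrite sS; apply: (le_trans (rnormD _ _)).
  have := rnormM y (s n); have := rnorm_ge0 (s n); have := rnorm_ge0 y; nra.
have yb n : rnorm (y ^+ n) <= (2^-1) ^+ n * rnorm 1.
  elim: n => [|n ih]; first by rewrite !expr0 mul1r.
  rewrite exprS (le_trans (rnormM _ _)) // exprS -mulrA.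
  by apply: ler_pM => //; exact: rnorm_ge0.
have sD n m : s (n + m)%N - s n = y ^+ n * s m.
  elim: n => [|n ih]; first by rewrite add0n expr0 mul1r /s big_ord0 subr0.
  by rewrite addSn !sS opprD addrACA subrr add0r -mulrBr ih mulrA -exprS.
have n1 := rnorm_ge0 1.
have cs : cauchy (s @ \oo).
  apply: cauchy_exP => e e0.
  have eE : e = (complex.Re e)%:C%C by rewrite RRe_real // gtr0_real.
  have re0 : 0 < complex.Re e by rewrite -ltcR -eE.
  have c0 := mulr_ge0 n1 (mulr_ge0 (ler0n _ 2) n1).
  have [N hN] := exp_half_small c0 re0.
  exists (s N); change (\forall n \near \oo, ball (s N) e (s n)); near=> n.
  have Nn : (N <= n)%N by near: n; exact: nbhs_infty_ge.
  rewrite -ball_normE /ball_ /= distrC -(subnKC Nn) sD rnormE eE ltcR.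
  apply: le_lt_trans hN; apply: (le_trans (rnormM _ _)); rewrite [leRHS]mulrA.
  by apply: ler_pM; rewrite ?rnorm_ge0 ?yb ?sb.
have /cauchy_cvgP/cvg_ex [w sw] := cs.
have swn e : 0 < e -> exists n, rnorm (w - s n) < e /\ rnorm (y ^+ n) < e.
  move=> e0; have [N hN] := exp_half_small n1 e0.
  have ec0 : 0 < e%:C%C by rewrite ltcR.
  have /cvgrPdist_lt/(_ _ ec0) sw' := sw.
  near \oo => n; exists n; split.
    rewrite -ltcR -rnormE; near: n; exact: sw'.
  apply: (le_lt_trans (yb n)); apply: le_lt_trans hN; rewrite ler_wpM2r //.
  rewrite !exprVn lef_pV2 ?posrE ?exprn_gt0 // ler_weXn2l ?ler1n //.
  by near: n; exact: nbhs_infty_ge.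
(* Passage to the limit: both terms on the right become small for a common [n]. It is applied to the
   defects of [w] as a right and as a left inverse. *)
have lim0 v C : (forall n, rnorm v <= C * rnorm (w - s n) + rnorm (y ^+ n)) -> v = 0.
  move=> vb; apply/rnorm_eq0/eqP; rewrite eq_le rnorm_ge0 andbT leNgt.
  apply/negP => v0; pose D := `|C| + 1.
  have D0 : 0 < D by rewrite /D; have := normr_ge0 C; lra.
  have [n [h1 h2]] := swn _ (divr_gt0 v0 D0).
  have e : rnorm v / D * D = rnorm v by rewrite divfK // gt_eqF.
  have : C * rnorm (w - s n) <= `|C| * (rnorm v / D).
    apply: (@le_trans _ _ (`|C| * rnorm (w - s n))).
      by rewrite ler_wpM2r ?ler_norm ?rnorm_ge0.
    by rewrite ler_wpM2l // ltW.
  by have := vb n; rewrite /D in e h2 *; lra.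
have wl : (1 - y) * w = 1.
  apply/subr0_eq/(lim0 _ (rnorm (1 - y))) => n.
  have -> : (1 - y) * w - 1 = (1 - y) * (w - s n) - y ^+ n.
    by rewrite mulrBr sl opprB addrA addrAC addrK.
  by apply: (le_trans (rnormD _ _)); rewrite rnormN lerD2r rnormM.
have wr : w * (1 - y) = 1.
  apply/subr0_eq/(lim0 _ (rnorm (1 - y))) => n.
  have -> : w * (1 - y) - 1 = (w - s n) * (1 - y) - y ^+ n.
    by rewrite mulrBl sr opprB addrA addrAC addrK.
  by apply: (le_trans (rnormD _ _)); rewrite rnormN lerD2r mulrC rnormM.
exists w; split=> //.
have wE : w = 1 + y * w by rewrite -[X in X + _]wl mulrBl mul1r subrK.
have := rnormD 1 (y * w); rewrite -wE; have := rnormM y w; have := rnorm_ge0 w.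
have := rnorm_ge0 y; nra.
Unshelve. all: by end_near. Qed.

(** A Liouville argument run on the norm of [r] itself, without functionals or contour integrals:
    the resolvent identity gives continuity and the approximate mean value inequality, the growth
    bound gives decay, and the maximum principle applies. *)
Lemma pseudo_resolvent_eq0 (r : R[i] -> A) (C D : R) :
  (forall z1 z2, r z1 - r z2 = (z1 - z2) *: (r z1 * r z2)) ->
  (forall z, normc z * rnorm (r z) <= C * rnorm (r z) + D) -> r 0 = 0.
Proof.
move=> res dec; pose f (p : R * R) := rnorm (r (p.1 +i* p.2)%C).
have f0 p : 0 <= f p by exact: rnorm_ge0.
suff : f (0, 0) = 0 by move/rnorm_eq0.
apply: subharmonic_decay_eq0 => //.
- apply: resolvent_bound_continuous => // p q.
  rewrite /f; apply: (le_trans (rnorm_dist _ _)); rewrite res rnormZ.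
  apply: ler_pM; rewrite ?rnorm_ge0 ?sqrtr_ge0 //.
    exact: normc_le_abs.
  exact: rnormM.
- move=> s t h; pose z0 := (s +i* t)%C : R[i]; set X := r z0.
  have step z : r (z0 + z) = X + z *: (X * r (z0 + z)).
    have := res z0 (z0 + z); rewrite -/X opprD addrA subrr sub0r scaleNr => h1.
    by rewrite -[LHS](subKr X) h1 opprK.
  pose i := (0 +i* 1)%C : R[i].
  have ii : i ^+ 2 = -1 by exact: sqr_i.
  pose hc := h%:C%C.
  have E1 : ((s + h)%R +i* t)%C = z0 + hc by rewrite /z0 /hc; simpc.
  have E2 : (s +i* (t + h)%R)%C = z0 + i * hc by rewrite /z0 /hc /i; simpc.
  have E3 : ((s - h)%R +i* t)%C = z0 - hc by rewrite /z0 /hc; simpc.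
  have E4 : (s +i* (t - h)%R)%C = z0 - i * hc by rewrite /z0 /hc /i; simpc.
  rewrite /f /= E1 E2 E3 E4 -/z0 -/X.
  have := resolvent_mean ii (step hc) (step (i * hc)) (step (- hc)) (step (- (i * hc))).
  set r1 := r (z0 + hc); set r2 := r (z0 + i * hc).
  set r3 := r (z0 - hc); set r4 := r (z0 - i * hc).
  set S := r1 + r3 + (r2 + r4) => SE.
  have Sle : rnorm S <= rnorm r1 + rnorm r2 + rnorm r3 + rnorm r4.
    have := rnormD (r1 + r3) (r2 + r4); have := rnormD r1 r3.
    by have := rnormD r2 r4; rewrite -/S; lra.
  have n4 : 4 * rnorm X = rnorm ((4 : R[i]) *: X).
    by rewrite rnormZ normc_nat.
  have nh : normc (hc ^+ 4) = h ^+ 4 by rewrite normc_real4.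
  have nX : rnorm (X ^+ 4 * S) <= rnorm X ^+ 4 * rnorm S.
    apply: (le_trans (rnormM _ _)); rewrite ler_wpM2r ?rnorm_ge0 //.
    have n2 : rnorm (X ^+ 2) <= rnorm X ^+ 2 by rewrite !expr2 rnormM.
    rewrite (exprM X 2 2) (exprM (rnorm X) 2 2) [in leLHS]expr2 [in leRHS]expr2.
    apply: (le_trans (rnormM _ _)); apply: ler_pM; rewrite ?rnorm_ge0 //.
  rewrite n4 SE; apply: (le_trans (rnormD _ _)); rewrite rnormN rnormZ nh.
  have h4 : 0 <= h ^+ 4 by rewrite (exprM h 2 2) sqr_ge0.
  have X4 : 0 <= rnorm X ^+ 4 by rewrite exprn_ge0 ?rnorm_ge0.
  apply: (@le_trans _ _ (rnorm S * (1 + h ^+ 4 * rnorm X ^+ 4))).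
    by have := ler_wpM2l h4 nX; lra.
  by rewrite ler_wpM2r // addr_ge0 // mulr_ge0.
(* Past this radius, [f p > e] would give [(normc z - C) * f p > D], contradicting the growth
   bound. *)
- move=> e e0; exists (`|C| + `|D| / e + 1).
    by rewrite ltr_wpDl // addr_ge0 // divr_ge0 // ltW.
  move=> p hp; rewrite leNgt; apply/negP => fe.
  have [n1 n2] := normc_ge_abs p.1 p.2.
  have {hp n1 n2} hp : `|C| + `|D| / e + 1 <= normc (p.1 +i* p.2)%C.
    by case: hp => hp; [apply: le_trans n1|apply: le_trans n2].
  have := dec (p.1 +i* p.2)%C; rewrite -/(f p).
  have De : `|D| / e * e = `|D| by rewrite divfK // gt_eqF.
  have : 0 <= `|D| / e by rewrite divr_ge0 // ltW.
  have := ler_norm C; have := ler_norm D; nra.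
Qed.
End BanachNorm.

(** * Minimal idempotents in Banach algebras, the socle, and expansions of inverses *)

Section BanachSocle.
Variables (R : realType) (A : banachAlgType R[i]).
Implicit Types (a b d e x y : A) (k z : R[i]) (L : set A).

(** If [x] is no multiple of [e], every [x - z *: e] is invertible in the corner at [e]. The
    inverses form a resolvent satisfying the growth bound, so the one at [z = 0] vanishes,
    contradicting [e <> 0]. *)
Lemma gelfand_mazur e x : e * e = e -> e <> 0 -> e * x = x -> x * e = x ->
  (forall y, e * y = y -> y * e = y -> y <> 0 -> exists w, w * y = e) ->
  exists k, x = k *: e.
Proof.
move=> ee e0 ex xe div; apply: contrapT => nk.
(* Left inverses become two-sided by taking a left inverse of the left inverse. *)
have inv y : e * y = y -> y * e = y -> y <> 0 ->
    exists w, [/\ e * w = w, w * e = w, w * y = e & y * w = e].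
  move=> ey ye y0; have [v vy] := div _ ey ye y0.
  pose w := e * v * e.
  have ew : e * w = w by rewrite /w !mulrA ee.
  have we : w * e = w by rewrite /w -mulrA ee.
  have wy : w * y = e by rewrite /w -mulrA ey -mulrA vy ee.
  have w0 : w <> 0 by move=> w0; apply: e0; rewrite -wy w0 mul0r.
  have [u uw] := div _ ew we w0.
  exists w; split=> //.
  have E : u * (w * y) * w = e * (y * w) by rewrite mulrA uw mulrA.
  rewrite -[LHS]mul1r.
  have -> : 1 * (y * w) = e * (y * w) by rewrite mul1r mulrA ey.
  by rewrite -E wy -mulrA ew uw.
have /choice [r rP] : forall z, exists w,
    [/\ e * w = w, w * e = w, w * (x - z *: e) = e & (x - z *: e) * w = e].
  move=> z; apply: inv.
  - by rewrite mulrBr -scalerAr ee ex.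
  - by rewrite mulrBl -scalerAl ee xe.
  - by move/subr0_eq => xz; apply: nk; exists z.
have r0 : r 0 = 0.
  apply: (@pseudo_resolvent_eq0 _ _ r (rnorm x) (rnorm e)) => [z1 z2|z].
    have [e1 e1' r1 r1'] := rP z1; have [e2 e2' r2 r2'] := rP z2.
    have -> : r z1 - r z2 = r z1 * ((x - z2 *: e) * r z2) - r z1 * (x - z1 *: e) * r z2.
      by rewrite r2' r1 e1' e2.
    rewrite !mulrA -mulrBl -mulrBr opprB addrC addrA subrK -scalerBl.
    by rewrite -scalerAr e1' -scalerAl.
  have [e1 e1' r1 r1'] := rP z.
  have zr : z *: r z = x * r z - e.
    by rewrite -r1' mulrBl -scalerAl e1 opprB addrC subrK.
  rewrite -rnormZ zr; apply: (le_trans (rnormD _ _)).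
  by rewrite rnormN lerD2r rnormM.
have [_ _ + _] := rP 0.
by rewrite r0 mul0r; exact: nesym.
Qed.

(** Brauer's lemma: choose [b] in [L] with [L b] nonzero. Minimality gives [L b = L], hence [e] in
    [L] with [e * b = b], and right multiplication by [b] is injective on [L], so [y * e = y]
    there. *)
Lemma minimal_left_ideal_idempotent L : semiprime A -> minimal_left_ideal L ->
  exists2 e, minimal_idempotent e & forall y, L y -> y * e = y.
Proof.
move=> spA [[L0 LD LM] Ln0 Lmin].
have [a La a0] : exists2 a, L a & a <> 0.
  apply: contrapT => h; apply: Ln0; apply/seteqP; split=> [y Ly|_ ->//].
  by apply: contrapT => y0; apply: h; exists y.
have [x axa] : exists x, a * x * a <> 0.
  apply: contrapT => h; apply: a0; apply: spA => x.
  by apply: contrapT => hx; apply: h; exists x.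
pose b := x * a; have Lb : L b by exact: LM.
have ab : a * b <> 0 by rewrite /b mulrA.
have left_mul c (P : set A) : left_ideal P -> left_ideal [set y * c | y in P].
  move=> [P0 PD PM]; split; first by exists 0; rewrite ?mul0r.
    by move=> _ _ [u Pu <-] [v Pv <-]; exists (u + v); rewrite ?mulrDl //; exact: PD.
  by move=> u _ [v Pv <-]; exists (u * v); rewrite -?mulrA //; exact: PM.
have [Lbc|Lbc] : [set y * b | y in L] = [set 0] \/ [set y * b | y in L] = L.
- apply: Lmin; first by apply: left_mul.
  by move=> _ [v Lv <-]; exact: LM.
- have : [set y * b | y in L] (a * b) by exists a.
  by rewrite Lbc.
have [e Le eb] : [set y * b | y in L] b by rewrite Lbc.
pose N := [set y | L y /\ y * b = 0].
have N0 : N = [set 0].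
  have [//|NL] : N = [set 0] \/ N = L.
    apply: Lmin; last by move=> y [].
    split; first by split; rewrite ?mul0r.
      by move=> u v [Lu ub] [Lv vb]; split; [exact: LD|rewrite mulrDl ub vb addr0].
    by move=> u v [Lv vb]; split; [exact: LM|rewrite -mulrA vb mulr0].
  by have [] : N a by rewrite NL.
have LE y : L y -> y * e = y.
  move=> Ly; apply/subr0_eq.
  have : N (y * e - y).
    split; last by rewrite mulrBl -mulrA eb subrr.
    by rewrite -mulN1r; apply: LD; apply: LM.
  by rewrite N0.
have ee := LE _ Le.
have e0 : e <> 0 by move=> e0; apply: ab; rewrite -eb e0 mul0r mulr0.
exists e => //; split=> //; split=> // y.
apply: (gelfand_mazur ee e0); rewrite ?mulrA ?ee // -?mulrA ?ee //.
(* A nonzero [u] of the corner generates [L] as a left ideal, so [e] is a left multiple of [u], as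
   Gelfand-Mazur requires. *)
move=> u eu ue u0.
have [h|h] : [set v * u | v in setT] = [set 0] \/ [set v * u | v in setT] = L.
- apply: Lmin; first by apply: left_mul; split.
  by move=> _ [v _ <-]; rewrite -ue mulrA; exact: LM.
- case: u0; have : [set v * u | v in setT] (e * u) by exists e.
  by rewrite h eu.
by have [v _ vu] : [set v * u | v in setT] e; [rewrite h|exists v].
Qed.

(** If [x] lay outside a maximal left ideal [L], then [1 = l + a * x] with [l] in [L]; but [a * x]
    has square zero, so [l = 1 - a * x] is a unit and [L] is everything. *)
Lemma semisimple_semiprime : semisimple A -> semiprime A.
Proof.
move=> ssA x xAx; suff : jacobson_radical x by rewrite ssA.
move=> L [[L0 LD LM] Lp Lmax]; apply: contrapT => nLx.
pose J := [set y | exists l a, L l /\ y = l + a * x].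
have JL : left_ideal J.
  split; first by exists 0, 0; rewrite mul0r addr0.
    move=> _ _ [l [a [Ll ->]]] [m [b [Lm ->]]]; exists (l + m), (a + b).
    by split; [exact: LD|rewrite mulrDl addrACA].
  move=> u _ [l [a [Ll ->]]]; exists (u * l), (u * a).
  by split; [exact: LM|rewrite mulrDr mulrA].
have LJ : L `<=` J by move=> l Ll; exists l, 0; rewrite mul0r addr0.
case: (Lmax J JL LJ) => JE.
  by apply: nLx; rewrite -JE; exists 0, 1; rewrite mul1r add0r.
have [l [a [Ll lE]]] : J 1 by rewrite JE.
apply: Lp; apply/seteqP; split=> // y _; rewrite -[y]mulr1; apply: (LM y).
have -> : 1 = (1 + a * x) * l.
  have -> : l = 1 - a * x by rewrite lE addrK.
  have axax : a * x * (a * x) = 0.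
    by rewrite -mulrA (mulrA x) xAx mulr0.
  by rewrite mulrDl mul1r mulrBr mulr1 axax subr0 subrK.
exact: LM.
Qed.

(** The left annihilator [J] of the socle is an ideal meeting the socle in a part that semiprimeness
    makes zero, so [J] is zero by essentiality. An element killing all minimal idempotents lies in
    [J], as a rank-one [y] factors as [(y * z) * y] with [y * z] a minimal idempotent. *)
Lemma essential_socle_faithful : semiprime A -> essential_ideal (@socle A) ->
  faithful_socle A.
Proof.
move=> spA [[[S0 SD SM] SR] Sn0 Sess] d dE.
pose J : set A := [set d | forall s : A, socle s -> d * s = 0].
have Jd : J d.
  move=> _ [s hs ->]; rewrite mulr_sumr big_seq big1 // => y /hs [L mL Ly].
  have [e me ye] := minimal_left_ideal_idempotent spA mL.
  apply: contrapT => dy.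
  have ry : rank_one y.
    rewrite -(ye _ Ly); apply: rank_one_mull; first exact: me.2.
    by rewrite ye // => y0; apply: dy; rewrite y0 mulr0.
  have [z yzy mz] := minimal_idempotent_mulr spA ry.
  by apply: dy; rewrite -yzy mulrA dE // mul0r.
have iJ : ideal J.
  split; first split.
  - by move=> s _; rewrite mul0r.
  - by move=> u v Ju Jv s Ss; rewrite mulrDl Ju // Jv // addr0.
  - by move=> u v Jv s Ss; rewrite -mulrA Jv // mulr0.
  - by move=> u v Ju s Ss; rewrite -mulrA Ju //; exact: SM.
apply: contrapT => d0.
apply: (Sess J iJ).
  by move=> J0; apply: d0; move: Jd; rewrite J0.
apply/seteqP; split=> [z [Sz Jz]|_ ->]; last by split=> // s _; rewrite mul0r.
by apply: spA => y; rewrite -mulrA Jz //; exact: SM.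
Qed.

(** Compress by [e] the expansion of [w] to order two, whose exact remainder is
    [c ^+ 3 *: (x ^+ 3 * w)] with [c] the complex image of [t]. The radius makes [c *: x] of norm at
    most one half, so [neumann_inverse] bounds [w] uniformly. *)
Lemma corner_inverse_expansion e x k1 k2 : minimal_idempotent e ->
  e * x * e = k1 *: e -> e * x ^+ 2 * e = k2 *: e ->
  exists r C, [/\ 0 < r, 0 <= C & forall t : R, `|t| <= r -> exists w k,
    [/\ (1 - t%:C%C *: x) * w = 1, w * (1 - t%:C%C *: x) = 1, e * w * e = k *: e
      & normc (k - 1 - t%:C%C * k1 - t%:C%C ^+ 2 * k2) <= C * `|t| ^+ 3]].
Proof.
move=> [ee [e0 ke]] x1 x2.
have E0 := rnorm_gt0 e0; have X0 := rnorm_ge0 x.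
exists (2 * (rnorm x + 1))^-1.
exists (rnorm e * rnorm (x ^+ 3) * (2 * rnorm (1 : A))).
have D0 : 0 < 2 * (rnorm x + 1) by lra.
split; first by rewrite invr_gt0.
  by rewrite !mulr_ge0 ?rnorm_ge0.
move=> t tr.
have nt : normc t%:C%C = `|t| by rewrite /= expr0n addr0 sqrtr_sqr.
have [|w [w1 w2 wn]] := @neumann_inverse R A (t%:C%C *: x).
  rewrite rnormZ nt.
  have : `|t| * (2 * (rnorm x + 1)) <= 1 by rewrite -ler_pdivlMr // div1r.
  have := normr_ge0 t; lra.
have [k kE] := ke w; exists w, k; split=> //.
set c := t%:C%C in w1 w2 nt *.
have wE : w = 1 + c *: (x * w).
  by rewrite -[X in X + _]w1 mulrBl mul1r scalerAl subrK.
have wE3 : w = 1 + c *: x + c ^+ 2 *: x ^+ 2 + c ^+ 3 *: (x ^+ 3 * w).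
  have En n : x ^+ n * w = x ^+ n + c *: (x ^+ n.+1 * w).
    by rewrite {1}wE mulrDr mulr1 -scalerAr mulrA -exprSr.
  rewrite {1}wE -{1}[x]expr1 (En 1%N) (En 2%N) !scalerDr !scalerA.
  by rewrite -!expr2 -!exprSr expr1 !addrA.
have ewe : k *: e = e + (c * k1) *: e + (c ^+ 2 * k2) *: e +
    c ^+ 3 *: (e * (x ^+ 3 * w) * e).
  rewrite -kE {1}wE3 !mulrDr !mulrDl mulr1 ee -!scalerA -x1 -x2.
  by rewrite -!scalerAr -!scalerAl.
have key : (k - 1 - c * k1 - c ^+ 2 * k2) *: e = c ^+ 3 *: (e * (x ^+ 3 * w) * e).
  rewrite !scalerBl scale1r; apply/eqP; rewrite !subr_eq ewe; apply/eqP.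
  rewrite addrC -[RHS]addrA -[RHS]addrA; congr (_ + _).
  by rewrite addrC; congr (_ + _); rewrite addrC.
have nkey : normc (k - 1 - c * k1 - c ^+ 2 * k2) * rnorm e =
    `|t| ^+ 3 * rnorm (e * (x ^+ 3 * w) * e).
  by rewrite -rnormZ key rnormZ !exprS expr0 !normcM nt normc1.
have bnd : rnorm (e * (x ^+ 3 * w) * e) <=
    rnorm e * rnorm (x ^+ 3) * (2 * rnorm (1 : A)) * rnorm e.
  apply: (le_trans (rnormM _ _)); rewrite ler_wpM2r ?rnorm_ge0 //.
  apply: (le_trans (rnormM _ _)); rewrite -mulrA ler_wpM2l ?rnorm_ge0 //.
  by apply: (le_trans (rnormM _ _)); rewrite ler_wpM2l ?rnorm_ge0.
have t3 : 0 <= `|t| ^+ 3 by rewrite exprn_ge0.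
by rewrite -(ler_pM2r E0) nkey; have := ler_wpM2l t3 bnd; lra.
Qed.

End BanachSocle.

(** * Comparison of coefficients in a real parameter *)

Lemma le_linear_eq0 (R : realType) (x C r : R) : 0 <= x -> 0 < r ->
  (forall t, 0 < t -> t <= r -> x <= C * t) -> x = 0.
Proof.
move=> x0 r0 h; apply/eqP; rewrite eq_le x0 andbT leNgt; apply/negP => xp.
pose D := `|C| * r + x + x.
have cr : 0 <= `|C| * r by rewrite mulr_ge0 // ltW.
have D0 : 0 < D by rewrite /D; lra.
have q1 : x / D <= 1 by rewrite ler_pdivrMr // mul1r /D; lra.
have q0 : 0 < x / D by rewrite divr_gt0.
have qE : x / D * D = x by rewrite divfK // gt_eqF.
have t0 : 0 < r * (x / D) by rewrite mulr_gt0.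
have tr : r * (x / D) <= r by rewrite ger_pMr.
have := h _ t0 tr; have := ler_wpM2r (ltW t0) (ler_norm C).
rewrite /D in qE *; nra.
Qed.

Lemma quadratic_small_eq (R : realType) (k1 k2 l1 l2 : R[i]) (C r : R) : 0 < r ->
  0 <= C ->
  (forall t : R, `|t| <= r -> normc (t%:C%C * (k1 - l1) + t%:C%C ^+ 2 * (k2 - l2))
     <= C * `|t| ^+ 3) ->
  k1 = l1 /\ k2 = l2.
Proof.
move=> r0 C0; set a := k1 - l1; set b := k2 - l2 => h.
have ntc t : 0 < t -> normc (t%:C%C : R[i]) = t.
  by move=> t0; rewrite /= expr0n addr0 sqrtr_sqr gtr0_norm.
(* Adding and subtracting the estimates at [t] and [- t] separates the linear from the quadratic
   coefficient. *)
have key t : 0 < t -> t <= r -> normc a <= C * t ^+ 2 /\ normc b <= C * t.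
  move=> t0 tr; have nt := gtr0_norm t0.
  have := h t; have := h (- t); rewrite normrN nt rmorphN sqrrN mulNr.
  set u := _ * a; set v := _ * b => /(_ tr) h2 /(_ tr) h1.
  have two (z : R[i]) : normc (2 * z) = 2 * normc z by rewrite normcM normc_nat.
  have hu : normc (2 * u) <= 2 * (C * t ^+ 3).
    have -> : 2 * u = (u + v) + - (- u + v) by ring.
    by apply: (le_trans (le_normcD _ _)); rewrite normc_opp; lra.
  have hv : normc (2 * v) <= 2 * (C * t ^+ 3).
    have -> : 2 * v = (u + v) + (- u + v) by ring.
    by apply: (le_trans (le_normcD _ _)); lra.
  move: hu hv; rewrite !two /u /v expr2 !normcM ntc // => hu hv.
  split.
    by rewrite -(ler_pM2l t0); lra.
  by rewrite -(ler_pM2l (mulr_gt0 t0 t0)); lra.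
have a0 : normc a = 0.
  apply: (@le_linear_eq0 _ _ (C * r) r) => //; first exact: normc_ge0.
  move=> t t0 tr; have [h1 _] := key t t0 tr; apply: (le_trans h1).
  by rewrite expr2 mulrA ler_wpM2r ?(ltW t0) // ler_wpM2l.
have b0 : normc b = 0.
  apply: (@le_linear_eq0 _ _ C r) => //; first exact: normc_ge0.
  by move=> t t0 tr; have [_ h2] := key t t0 tr.
by split; apply/subr0_eq/eq0_normc.
Qed.

(** * From preservation of the minus order to a Jordan isomorphism *)

Section Preservers.
Variables (R : realType) (A B : banachAlgType R[i]).

Lemma compression_square (Psi : {linear A -> B}) (e x : A) (k1 k2 l1 l2 : R[i]) :
  Psi 1 = 1 -> (forall y, invertible y <-> invertible (Psi y)) ->
  minimal_idempotent e -> minimal_idempotent (Psi e) ->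
  e * x * e = k1 *: e -> e * x ^+ 2 * e = k2 *: e ->
  Psi e * Psi x * Psi e = l1 *: Psi e ->
  Psi e * Psi x ^+ 2 * Psi e = l2 *: Psi e ->
  k1 = l1 /\ k2 = l2.
Proof.
move=> Psi1 inv me mE x1 x2 X1 X2.
have [r [C [r0 C0 hA]]] := corner_inverse_expansion me x1 x2.
have [s [D [s0 D0 hB]]] := corner_inverse_expansion mE X1 X2.
apply: (@quadratic_small_eq _ _ _ _ _ (C + D) (Num.min r s)).
- by rewrite lt_min r0.
- by rewrite addr_ge0.
move=> t; rewrite le_min => /andP[/hA [w [k [w1 w2 wk kb]]] /hB [W [l [W1 W2 Wl lb]]]].
have PE : 1 - t%:C%C *: Psi x = Psi (1 - t%:C%C *: x).
  by rewrite [RHS]linearB [in RHS]linearZ /= Psi1.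
rewrite PE in W1 W2.
have kl := compression_inverse inv me mE w1 w2 W1 W2 wk Wl.
have -> : t%:C%C * (k1 - l1) + t%:C%C ^+ 2 * (k2 - l2) =
  (l - 1 - t%:C%C * l1 - t%:C%C ^+ 2 * l2) +
  - (k - 1 - t%:C%C * k1 - t%:C%C ^+ 2 * k2) by rewrite kl; ring.
apply: (le_trans (le_normcD _ _)); rewrite normc_opp; lra.
Qed.

Lemma preserves_minus_jordan (Phi : {linear A -> B}) :
  semiprime A -> faithful_socle A -> semiprime B -> faithful_socle B ->
  bijective Phi -> preserves_minus Phi ->
  exists (c : B) (Psi : {linear A -> B}),
    [/\ invertible c, jordan_isomorphism Psi & forall x : A, Phi x = c * Psi x].
Proof.
move=> spA fsA spB fsB bij pm.
have [Inv fK gK] := bijective_linear_inverse bij.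
have bijI : bijective Inv by exists Phi.
have pmI := preserves_minus_inv fK gK pm.
have inv1 (V : nzRingType) : invertible (1 : V) by exists 1; rewrite mulr1.
have invP x : invertible x <-> invertible (Phi x).
  split=> [|h]; first exact: preserves_minus_invertible.
  by rewrite -(fK x); apply: preserves_minus_invertible.
have invc := (invP 1).1 (inv1 A).
have [v [cv vc]] := invc; set c := Phi 1 in invc cv vc.
have invv : invertible v by exists c.
have invM (V : nzRingType) (a b : V) : invertible a -> invertible b -> invertible (a * b).
  move=> [a' [h1 h2]] [b' [h3 h4]]; exists (b' * a').
  by rewrite -!mulrA (mulrA b) h3 mul1r (mulrA a') h2 mul1r.
pose Psi : {linear A -> B} := v \*o Phi.
have PsiE x : Psi x = v * Phi x by [].
have PhiE x : Phi x = c * Psi x by rewrite PsiE mulrA cv mul1r.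
have Psi1 : Psi 1 = 1 by rewrite PsiE -/c.
have bijPsi : bijective Psi.
  exists (fun y => Inv (c * y)) => y; first by rewrite -PhiE fK.
  by rewrite PsiE gK mulrA vc mul1r.
have invPsi x : invertible x <-> invertible (Psi x).
  rewrite invP; split=> h; first by rewrite PsiE; exact: invM.
  by rewrite PhiE; exact: invM.
(* From [e] below [1] follows [Phi e] below [c]; the inner inverse [v] of [c] is then one of
   [Phi e], which says that [v * Phi e] is idempotent. *)
have idem e : minimal_idempotent e -> minimal_idempotent (Psi e).
  move=> [ee re]; split.
    have : minus_le (Phi e) c.
      apply/pm.2; [by exists e; rewrite ee ee|exact: invertible_regular|].
      by have := minimal_idempotent_le ee (inv1 A); rewrite mul1r.
    have cvc : c * v * c = c by rewrite cv mul1r.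
    move=> /minus_le_inner/(_ cvc) [h _ _].
    by rewrite !PsiE -mulrA (mulrA (Phi e)) h.
  rewrite PsiE; apply: rank_one_mull; first exact: preserves_minus_rank_one.
  rewrite -PsiE => h; apply: re.1; apply: (bij_inj bijPsi).
  by rewrite h linear0.
have idemI E : minimal_idempotent E -> exists2 e, minimal_idempotent e & Psi e = E.
  move=> [EE rE]; have [e eE] : exists e, Phi e = c * E by exists (Inv (c * E)).
  exists e; last by rewrite PsiE eE mulrA vc mul1r.
  have cE : minus_le (Phi e) c by rewrite eE; exact: minimal_idempotent_le.
  have rcE : rank_one (c * E).
    apply: rank_one_mull => // h; apply: rE.1.
    by rewrite -[LHS]mul1r -vc -mulrA h mulr0.
  have re : rank_one e.
    rewrite -(fK e) eE; apply: preserves_minus_rank_one => //.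
  split=> //.
  have : minus_le e 1.
    apply/pm.2 => //; [exact: rank_one_regular|exact: invertible_regular].
  have o1 : 1 * 1 * 1 = 1 :> A by rewrite !mulr1.
  by move=> /minus_le_inner/(_ o1) [+ _ _]; rewrite mulr1.
exists c, Psi; split=> //; split=> // x.
apply/esym/subr0_eq/(minimal_idempotent_sandwich spB fsB) => E /idemI [e me <-].
have mE := idem e me.
have [k1 x1] := me.2.2 x; have [k2 x2] := me.2.2 (x ^+ 2).
have [k4 x4] := me.2.2 ((x ^+ 2) ^+ 2).
have [l1 X1] := mE.2.2 (Psi x); have [l2 X2] := mE.2.2 (Psi x ^+ 2).
have [m2 Y2] := mE.2.2 (Psi (x ^+ 2)); have [m4 Y4] := mE.2.2 (Psi (x ^+ 2) ^+ 2).
(* The second-order coefficient at [x] and the first-order coefficient at [x ^+ 2] both equal the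
   compression [k2] of [x ^+ 2], so [Psi x ^+ 2] and [Psi (x ^+ 2)] have the same compression by
   [Psi e]. *)
have [_ kl] := compression_square Psi1 invPsi me mE x1 x2 X1 X2.
have [km _] := compression_square Psi1 invPsi me mE x2 x4 Y2 Y4.
by rewrite mulrBr mulrBl X2 Y2 -kl -km subrr.
Qed.

End Preservers.

Theorem theorem3p2 (R : realType) (A B : banachAlgType R[i])
    (ssA : semisimple A) (ssB : semisimple B)
    (socA : essential_ideal (@socle A)) (socB : essential_ideal (@socle B))
    (Phi : {linear A -> B}) (Phi_bij : bijective Phi) :
  (Phi @` @regular_elts A = @regular_elts B /\
   (forall a b : A, regular_elts a -> regular_elts b ->
      (minus_le a b <-> minus_le (Phi a) (Phi b))))
  <->
  (exists (c : B) (Psi : {linear A -> B}),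
     [/\ invertible c, jordan_isomorphism Psi
       & forall x : A, Phi x = c * Psi x]).
Proof.
have spA := semisimple_semiprime ssA; have spB := semisimple_semiprime ssB.
have fsA := essential_socle_faithful spA socA.
have fsB := essential_socle_faithful spB socB.
split=> [pm|[c [Psi [invc [jPsi bijPsi] PhiE]]]].
  exact: preserves_minus_jordan.
apply: (preserves_minus_mull invc PhiE).
by apply: jordan_preserves_minus => //; rewrite pnatr_eq0.
Qed.
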